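(* Let $n$ and $d$ be positive integers and let $m>n^{4d+13}$. Run $\mathrm{UNFAIR}(m,n,d)$, and for $1\le i\le n$ let $b_{i(m)}(m)$ denote the load of the $i^{th}$ smallest (least-loaded) bin after all $m$ balls have been placed. Then the expected load of the $i^{th}$ smallest bin is $$\left(\left(\tfrac{i}{n}\right)^d-\left(\tfrac{i-1}{n}\right)^d\right)m+O\!\left(\frac{m}{n^{d+1}}\right).$$ Furthermore, the probability that \emph{all} $n$ bins have load within $O(m/n^{d+1})$ of this expectation is $1-O(n^{-d})$.
   Context: The process $\mathrm{UNFAIR}(m,n,d)$ places $m$ balls, one at a time, into $n$ initially empty bins $B_1,\dots,B_n$. At each time step an option tuple $(i_1,\dots,i_d)$ is chosen uniformly at random from $\{1,\dots,n\}^d$ (i.e. $d$ bins chosen independently with replacement), and the ball is placed in the currently \emph{most}-loaded of the chosen bins; ties are broken uniformly at random among the most-loaded chosen bins. At each time $t$ the bins are relabeled in order of load: $i(t)$ denotes the original index of the $i^{th}$ lightest bin at time $t$ (ties in this ordering broken uniformly at random), and $b_{i(t)}(t)$ is its load at time $t$, so $b_{1(t)}(t)\le b_{2(t)}(t)\le\dots\le b_{n(t)}(t)$. Asymptotic notation refers to $n\to\infty$ with $d$ fixed. *)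

(* Defs.v *)
From mathcomp Require Import all_boot all_order all_algebra all_fingroup.
From mathcomp Require Import reals.

Set Implicit Arguments.
Unset Strict Implicit.
Unset Printing Implicit Defensive.

Import Order.TTheory GRing.Theory Num.Theory.
Local Open Scope ring_scope.

(* A history [h : seq 'I_n] lists the bins that received the balls thrown so
   far, in order of time; it determines all loads at all times. *)

Section Unfair.
Variables (R : realType) (n d : nat).

Definition load (h : seq 'I_n) (j : 'I_n) : nat := count_mem j h.

(* A set of bins: a bin occurring several times in [o] gets no extra weight in
   the tie-breaking. *)
Definition most_loaded (h : seq 'I_n) (o : d.-tuple 'I_n) : {set 'I_n} :=
  [set j in o | all (fun k => load h k <= load h j)%N o].

(* Conditional probability that the next ball goes to bin [j], given the
   history [h]: the sum averages over the uniform option tuple, and the second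
   factor is the uniform choice among the most-loaded options. *)
Definition step_pr (h : seq 'I_n) (j : 'I_n) : R :=
  \sum_(o : d.-tuple 'I_n)
    (n%:R ^+ d)^-1 * ((j \in most_loaded h o)%:R / #|most_loaded h o|%:R).

Definition history_pr (m : nat) (h : m.-tuple 'I_n) : R :=
  \prod_(t < m) step_pr (take t h) (tnth h t).

(* [s i] is the original index of the bin of rank [i]; ranks are counted from
   0, lightest first. *)
Definition rankings (h : seq 'I_n) : {set 'S_n} :=
  [set s : 'S_n | [forall i : 'I_n, forall j : 'I_n,
     (i <= j)%N ==> (load h (s i) <= load h (s j))%N]].

(* An outcome is a history of all [m] balls together with the final ranking,
   which is drawn uniformly from [rankings]; this is the same as breaking ties
   uniformly at random.  Rankings at earlier times do not influence the
   process. *)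
Definition outcome (m : nat) : finType := (m.-tuple 'I_n * 'S_n)%type.

Definition unfair_pr (m : nat) (w : outcome m) : R :=
  history_pr w.1 * ((w.2 \in rankings w.1)%:R / #|rankings w.1|%:R).

Definition ranked_load (m : nat) (i : 'I_n) (w : outcome m) : nat :=
  load w.1 (w.2 i).

Definition unfair_E (m : nat) (X : outcome m -> R) : R :=
  \sum_(w : outcome m) unfair_pr w * X w.

Definition expected_load (m : nat) (i : 'I_n) : R :=
  @unfair_E m (fun w => (ranked_load i w)%:R).

Definition unfair_Pr (m : nat) (A : {set outcome m}) : R :=
  \sum_(w in A) unfair_pr w.

Lemma uniform_sum1 (T : finType) (A : {set T}) :
  (0 < #|A|)%N -> \sum_(x : T) (x \in A)%:R / #|A|%:R = 1 :> R.
Proof.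
move=> A0; rewrite -mulr_suml -natr_sum -big_mkcond sum1_card divff //.
by rewrite pnatr_eq0 -lt0n.
Qed.

Lemma most_loaded_gt0 h o : (0 < d)%N -> (0 < #|most_loaded h o|)%N.
Proof.
move=> d0; pose k0 := tnth o (Ordinal d0).
have k0o : k0 \in o by exact: mem_tnth.
have [j jo jmax] := arg_maxnP (load h) k0o.
apply/card_gt0P; exists j; rewrite !inE; apply/andP; split=> //.
by apply/allP => k ko; exact: jmax.
Qed.

Lemma rankings_gt0 h : (0 < #|rankings h|)%N.
Proof.
pose r := relpre (load h) leq.
have rtot : total r by move=> x y; exact: leq_total.
have rtr : transitive r by move=> y x z; exact: leq_trans.
pose t := sort r (enum 'I_n).
have st : size t = n by rewrite size_sort -cardE card_ord.
have ut : uniq t by rewrite sort_uniq enum_uniq.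
have finj : injective (fun i : 'I_n => nth i t i).
  move=> i j /= e; apply/val_inj/eqP.
  rewrite -(nth_uniq i _ _ ut) ?st ?ltn_ord //.
  by rewrite e (set_nth_default i j) ?st ?ltn_ord.
apply/card_gt0P; exists (perm finj); rewrite inE.
apply/forallP => i; apply/forallP => j; apply/implyP => ij.
rewrite !permE (set_nth_default i j) ?st ?ltn_ord //.
have rr : reflexive r by move=> x; exact: leqnn.
have it (k : 'I_n) : (k : nat) \in [pred k | k < size t]%N by rewrite inE st ltn_ord.
exact: (sorted_leq_nth rtr rr i (sort_sorted rtot _) i j (it i) (it j) ij).
Qed.

Lemma step_pr_sum1 h : (0 < n)%N -> (0 < d)%N -> \sum_j step_pr h j = 1.
Proof.
move=> n0 d0; rewrite exchange_big /=.
under eq_bigr => o _ do rewrite -mulr_sumr uniform_sum1 ?most_loaded_gt0 // mulr1.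
rewrite sumr_const card_tuple card_ord -[LHS]mulr_natl natrX divff //.
by rewrite expf_neq0 // pnatr_eq0 -lt0n.
Qed.

Lemma history_pr_sum1 m : (0 < n)%N -> (0 < d)%N ->
  \sum_(h : m.-tuple 'I_n) history_pr h = 1.
Proof.
move=> n0 d0; elim: m => [|m IH].
  rewrite (big_pred1 [tuple]) => [|h]; last first.
    by rewrite [h]tuple0; apply/esym/eqP.
  by rewrite /history_pr big_ord0.
pose f (p : m.-tuple 'I_n * 'I_n) : m.+1.-tuple 'I_n := [tuple of rcons p.1 p.2].
pose g (h : m.+1.-tuple 'I_n) : m.-tuple 'I_n * 'I_n :=
  ([tuple of belast (thead h) (behead h)], last (thead h) (behead h)).
have fg h : f (g h) = h.
  by apply: val_inj => /=; rewrite -lastI [in RHS](tuple_eta h).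
have gf p : g (f p) = p.
  have := congr1 val (fg (f p)) => /= /rcons_inj[e1 e2].
  by case: p e1 e2 => a b /= e1 e2; congr (_, _); first exact: val_inj.
rewrite (reindex f) /=; last by exists g => ? _.
rewrite -(pair_bigA _ (fun a b => history_pr (f (a, b)))) /= -{}[RHS]IH.
apply: eq_bigr => a _; rewrite -[RHS]mulr1 -(step_pr_sum1 a n0 d0) mulr_sumr.
apply: eq_bigr => b _; rewrite /history_pr big_ord_recr /=; congr (_ * _).
  apply: eq_bigr => t _; rewrite (tnth_nth b) /= (tnth_nth b) nth_rcons size_tuple.
  by rewrite ltn_ord -cats1 takel_cat // size_tuple ltnW.
rewrite (tnth_nth b) /= nth_rcons size_tuple ltnn eqxx -cats1 take_cat.
by rewrite size_tuple ltnn subnn take0 cats0.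
Qed.

Lemma unfair_pr_ge0 m (w : outcome m) : 0 <= unfair_pr w.
Proof.
rewrite mulr_ge0 ?divr_ge0 ?ler0n // prodr_ge0 // => t _.
by rewrite sumr_ge0 // => o _; rewrite mulr_ge0 ?divr_ge0 ?invr_ge0 ?exprn_ge0 ?ler0n.
Qed.

Lemma unfair_pr_sum1 m : (0 < n)%N -> (0 < d)%N ->
  \sum_(w : outcome m) unfair_pr w = 1.
Proof.
move=> n0 d0; rewrite -(history_pr_sum1 m n0 d0) -(pair_bigA _ (fun a b => unfair_pr (a, b))).
apply: eq_bigr => h _; rewrite /unfair_pr /= -mulr_sumr uniform_sum1 ?mulr1 //.
exact: rankings_gt0.
Qed.

End Unfair.

(* Main.v *)
Require Import Defs.
From mathcomp Require Import all_boot all_order all_algebra all_fingroup.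
From mathcomp Require Import reals ring lra zify.

Set Implicit Arguments.
Unset Strict Implicit.
Unset Printing Implicit Defensive.

Import Order.TTheory GRing.Theory Num.Theory.
Local Open Scope ring_scope.

(** Write [p i] for the probability that the ball goes to the bin of rank [i]
    when there are no ties, and [b i] for the load of rank [i] after [t] balls.
    The potential [\sum_i (b i - p i * t) ^+ 2] grows by at most 1 per step in
    expectation, so its mean after [m] balls is at most [m].  Jensen and Markov
    with tolerance [m / n ^+ d.+1], whose square is far larger than [m], give
    both claims.  For the growth bound, expand the square: the expected increase
    [2 * \sum_i p i * b i + 1] of [\sum_i b i ^+ 2] cancels against the change of
    the factor [t] in [- 2 * t * \sum_i p i * b i], while
    [\sum_i p i * b i] increases by at least [\sum_i p i ^+ 2] in expectation.
    Ties only help there: adding a ball to a block of tied bins amounts to adding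
    it to the highest rank of that block, and [p] is nondecreasing. *)

(** * Counting and summation identities *)

Lemma card_ord_lt n m : (m <= n)%N -> #|[set k : 'I_n | (k < m)%N]| = m.
Proof.
move=> mn; rewrite -sum1dep_card -(big_ord_widen _ (fun=> 1%N) mn).
by rewrite sum1_card card_ord.
Qed.

Lemma sumr_indicator (R : pzSemiRingType) (I : finType) (a : pred I) :
  \sum_i (a i)%:R = #|[set i | a i]|%:R :> R.
Proof. by rewrite -natr_sum -sum1dep_card [in RHS]big_mkcond. Qed.

Lemma sumr_ltn_indicator (R : pzSemiRingType) (B x : nat) :
  (x <= B)%N -> \sum_(L < B) (L < x)%:R = x%:R :> R.
Proof. by move=> xB; rewrite sumr_indicator card_ord_lt. Qed.

Lemma card_tuple_all (T : finType) (a : pred T) d :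
  #|[set o : d.-tuple T | all a o]| = (#|a| ^ d)%N.
Proof.
have H := card_ffun_on 'I_d a; rewrite card_ord in H; rewrite -{}H.
rewrite -(card_imset _ (can_inj (@finfun_of_tupleK T d))); apply: eq_card => f.
apply/imsetP/ffun_onP => [[o]|fa].
  rewrite inE => /allP oa -> i; rewrite ffunE; apply: oa; exact: mem_tnth.
exists (tuple_of_finfun f); last by rewrite tuple_of_finfunK.
rewrite inE; apply/allP => _ /tnthP[i ->].
by rewrite tnth_map tnth_ord_tuple; exact: fa.
Qed.

Lemma big_tuple_rcons (R : Type) (idx : R) (op : Monoid.com_law idx)
    (T : finType) m (F : m.+1.-tuple T -> R) :
  \big[op/idx]_h F h =
  \big[op/idx]_(h : m.-tuple T) \big[op/idx]_j F [tuple of rcons h j].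
Proof.
rewrite pair_bigA /=.
pose f (p : m.-tuple T * T) : m.+1.-tuple T := [tuple of rcons p.1 p.2].
pose g (h : m.+1.-tuple T) : m.-tuple T * T :=
  ([tuple of belast (thead h) (behead h)], last (thead h) (behead h)).
have fg h : f (g h) = h.
  by apply: val_inj => /=; rewrite -lastI [in RHS](tuple_eta h).
have gf q : g (f q) = q.
  have := congr1 val (fg (f q)) => /= /rcons_inj[e1 e2].
  by case: q e1 e2 => a b /= e1 e2; congr (_, _); first exact: val_inj.
by rewrite (reindex f) //; exists g => ? _.
Qed.

Lemma sum_by_parts (R : comPzRingType) (a : nat -> R) B :
  \sum_(L < B.+1) (a L.+1 - a L) * L%:R = \sum_(L < B) (a B.+1 - a L.+1).
Proof.
elim: B => [|B IH]; first by rewrite big_ord1 mulr0 big_ord0.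
rewrite big_ord_recr /= IH big_ord_recr /= !sumrB !sumr_const !card_ord.
rewrite -[in RHS]mulr_natr -mulr_natr mulrS; ring.
Qed.

(** * Effect of one ball on the load profile and the potential *)

Section OneStep.
Variables (R : realType) (n d : nat).
Hypotheses (n_gt0 : (0 < n)%N) (d_gt0 : (0 < d)%N).
Implicit Types (h : seq 'I_n) (L : nat).

(** Distribution function of the highest of [d] independent uniform ranks: for [c <= n], the chance
    that all [d] options lie among the [c] lightest bins. *)
Definition max_rank_cdf (c : nat) : R := (c%:R / n%:R) ^+ d.
Definition rank_pr (c : nat) : R := max_rank_cdf c.+1 - max_rank_cdf c.
Local Notation P := max_rank_cdf.
Local Notation p := rank_pr.

Definition below h L : nat := #|[set k | (load h k < L)%N]|.

Lemma cdfn : P n = 1.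
Proof. by rewrite /P divff ?expr1n // pnatr_eq0 -lt0n. Qed.

Lemma rank_pr_ge0 c : 0 <= p c.
Proof.
rewrite subr_ge0 lerXn2r ?nnegrE ?divr_ge0 // ler_pM2r ?ler_nat //.
by rewrite invr_gt0 ltr0n.
Qed.

(** Convexity of [x ^+ d]: each increment factors as [1 / n] times a sum of products of powers of
    its endpoints, and these grow with the endpoints. *)
Lemma rank_pr_le a b : (a <= b)%N -> p a <= p b.
Proof.
elim: b => [|b IH]; first by rewrite leqn0 => /eqP->.
rewrite leq_eqVlt => /predU1P[-> //|/IH /le_trans]; apply.
rewrite /p /P !subrXX -!mulrBl -!natrB // !subSnn ler_wpM2l ?divr_ge0 //.
have le01 k : k%:R / n%:R <= k.+1%:R / n%:R :> R.
  by rewrite ler_wpM2r ?invr_ge0 // ler_nat.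
apply: ler_sum => i _.
by apply: ler_pM; rewrite ?exprn_ge0 ?divr_ge0 // lerXn2r ?nnegrE ?divr_ge0 ?ler0n ?le01.
Qed.

Lemma sum_rank_pr a b : (a <= b)%N -> \sum_(a <= c < b) p c = P b - P a.
Proof. exact: telescope_sumr. Qed.

Lemma below_le h L : (below h L <= n)%N.
Proof. by rewrite -[n in leqRHS]card_ord max_card. Qed.

Lemma below0 h : below h 0 = 0%N.
Proof. by apply: eq_card0 => k; rewrite inE. Qed.

Lemma below_mono h L : (below h L <= below h L.+1)%N.
Proof. by apply/subset_leq_card/subsetP => k; rewrite !inE; exact: ltnW. Qed.

Lemma load_le h j : (load h j <= size h)%N.
Proof. exact: count_size. Qed.

Lemma below_size h L : (size h < L)%N -> below h L = n.
Proof.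
move=> hL; rewrite -[n in RHS]card_ord; apply: eq_card => k; rewrite !inE.
exact: leq_ltn_trans (load_le _ _) hL.
Qed.

Lemma load_rcons h j k : load (rcons h j) k = (load h k + (j == k))%N.
Proof. by rewrite /load -cats1 count_cat /= addn0. Qed.

Lemma cdf_below h L :
  P (below h L) =
  (n%:R ^+ d)^-1 * \sum_(o : d.-tuple 'I_n) (all (fun k => load h k < L)%N o)%:R.
Proof.
by rewrite sumr_indicator card_tuple_all /P /below cardsE natrX expr_div_n mulrC.
Qed.

(** However ties are broken, the load of the bin hit is the maximum over the options, and this is
    below [L] exactly when all options are. So the increments of [P (below h _)] are the law of the
    load hit. *)
Lemma step_expectation h (g : nat -> R) B : (size h < B)%N ->
  \sum_j step_pr R d h j * g (load h j) =
  \sum_(L < B) (P (below h L.+1) - P (below h L)) * g L.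
Proof.
move=> hB.
have -> : \sum_j step_pr R d h j * g (load h j) =
    \sum_(o : d.-tuple 'I_n) \sum_j (n%:R ^+ d)^-1 *
      ((j \in most_loaded h o)%:R / #|most_loaded h o|%:R) * g (load h j).
  by rewrite exchange_big; apply: eq_bigr => j _; rewrite mulr_suml.
have -> : \sum_(L < B) (P (below h L.+1) - P (below h L)) * g L =
    \sum_(o : d.-tuple 'I_n) \sum_(L < B) (n%:R ^+ d)^-1 *
      ((all (fun k => load h k < L.+1)%N o)%:R
       - (all (fun k => load h k < L)%N o)%:R) * g L.
  rewrite exchange_big; apply: eq_bigr => L _.
  by rewrite !cdf_below -mulrBr -sumrB mulr_sumr mulr_suml.
apply: eq_bigr => o _.
have /card_gt0P[j0 j0o] := most_loaded_gt0 h o d_gt0.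
have [j0in /allP j0max] : j0 \in o /\ all (fun k => load h k <= load h j0)%N o.
  by move: j0o; rewrite inE => /andP.
have all_ltE L : all (fun k => load h k < L)%N o = (load h j0 < L)%N.
  apply/allP/idP => [/(_ _ j0in) //|j0L k /j0max kj0].
  exact: leq_ltn_trans kj0 j0L.
transitivity ((n%:R ^+ d)^-1 * g (load h j0)).
  transitivity (\sum_j (n%:R ^+ d)^-1 *
    ((j \in most_loaded h o)%:R / #|most_loaded h o|%:R) * g (load h j0)).
    apply: eq_bigr => j _; case: (boolP (j \in _)) => [|_]; last by rewrite !mul0r !mulr0 !mul0r.
    rewrite inE => /andP[jo /allP jmax]; congr (_ * g _).
    by apply/eqP; rewrite eqn_leq j0max ?jmax.
  by rewrite -mulr_suml -mulr_sumr uniform_sum1 ?mulr1 // most_loaded_gt0.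
have j0B : (load h j0 < B)%N by exact: leq_ltn_trans (load_le _ _) hB.
rewrite (bigD1 (Ordinal j0B)) //= big1 ?addr0 => [|L /negPf jL].
  by rewrite !all_ltE ltnS leqnn ltnn subr0 mulr1.
rewrite !all_ltE ltnS leq_eqVlt -[_ == _]/(Ordinal j0B == L) eq_sym jL.
by rewrite subrr mulr0 mul0r.
Qed.

Lemma below_rcons h j L :
  below h L.+1 = (below (rcons h j) L.+1 + (load h j == L))%N.
Proof.
rewrite /below (cardsD1 j) [in RHS](cardsD1 j) !inE load_rcons eqxx.
have -> : [set k | load (rcons h j) k < L.+1]%N :\ j = [set k | load h k < L.+1]%N :\ j.
  apply/setP => k; rewrite !inE load_rcons; case: eqVneq => //= kj.
  by rewrite addn0.
lia.
Qed.

(* Layer-cake form of [\sum_i p i * b i] (see [sorted_meanE]); it is independent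
   of the choice of a ranking, and one new ball changes a single summand. *)
Definition sorted_mean h : R := \sum_(L < size h) (1 - P (below h L.+1)).
Local Notation M := sorted_mean.

Lemma step_mean_load h : \sum_j step_pr R d h j * (load h j)%:R = M h.
Proof.
rewrite (step_expectation (fun L => L%:R) (ltnSn _)) (sum_by_parts (fun L => P (below h L))).
by rewrite below_size // cdfn.
Qed.

(* [(below h (load h j).+1).-1] is the highest rank in the block of bins tied
   with [j]. *)
Lemma sorted_mean_rcons h j :
  M (rcons h j) = M h + p (below h (load h j).+1).-1.
Proof.
have c_gt0 : (0 < below h (load h j).+1)%N.
  by apply/card_gt0P; exists j; rewrite inE.
(* The extra layer [L = size h] contributes zero because all [n] bins lie below [(size h).+1]; both
   sums now have the same range. *)
have -> : M h = \sum_(L < (size h).+1) (1 - P (below h L.+1)).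
  by rewrite big_ord_recr /= below_size // cdfn subrr addr0.
have hj : (load h j < (size h).+1)%N by rewrite ltnS load_le.
rewrite /M size_rcons (bigD1 (Ordinal hj)) //= [in RHS](bigD1 (Ordinal hj)) //=.
(* Only the count at threshold [(load h j).+1] changes: bin [j] leaves it. *)
have e := below_rcons h j (load h j); rewrite eqxx addn1 in e.
rewrite e /= /p [_ + _ + (_ - _)]addrAC; congr (_ + _); first by ring.
apply: eq_bigr => L /negPf jL; rewrite (below_rcons h j L).
by rewrite -[load h j == L]/(Ordinal hj == L) eq_sym jL addn0.
Qed.

Definition rank_energy : R := \sum_(c < n) p c ^+ 2.
Local Notation Q := rank_energy.

(** Bins of load [L] occupy the ranks [c] with [below h L <= c < below h L.+1]. This block is hit
    with probability the sum of its [p c], and a hit adds [p] at its top rank, which is at least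
    every [p c]; so it contributes at least its sum of [p c ^+ 2]. *)
Lemma step_sorted_mean_ge h :
  Q <= \sum_j step_pr R d h j * p (below h (load h j).+1).-1.
Proof.
rewrite (step_expectation (fun L => p (below h L.+1).-1) (ltnSn _)).
pose S c : R := \sum_(0 <= i < c) p i ^+ 2.
have -> : Q = \sum_(0 <= L < (size h).+1) (S (below h L.+1) - S (below h L)).
  by rewrite telescope_sumr // below0 below_size // /S big_nil subr0 big_mkord.
rewrite big_mkord; apply: ler_sum => L _.
have ab := below_mono h L.
rewrite -sum_rank_pr // /S (big_cat_nat (leq0n _) ab) //= addrAC subrr add0r mulr_suml.
apply: ler_sum_nat => c /andP[_ cb]; rewrite expr2 ler_wpM2l ?rank_pr_ge0 //.
by apply: rank_pr_le; rewrite -ltnS prednK // (leq_ltn_trans _ cb).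
Qed.

(** A ranking sorts the loads, so the ranks of load below [L] form an initial segment, whose length
    is the number of such bins. *)
Lemma below_ranked h (s : 'S_n) (i : 'I_n) L :
  s \in rankings h -> (load h (s i) < L)%N = (i < below h L)%N.
Proof.
rewrite inE => /forallP s_sorted.
have s_mono (a b : 'I_n) : (a <= b)%N -> (load h (s a) <= load h (s b))%N.
  by move=> ab; have /forallP/(_ b)/implyP := s_sorted a; apply.
pose A : {set 'I_n} := [set k | (load h (s k) < L)%N].
have -> : below h L = #|A|.
  rewrite -(card_imset _ (@perm_inj _ s)); apply: eq_card => k; rewrite inE.
  apply/idP/imsetP => [kL|[k']]; last by rewrite inE => ? ->.
  by exists (s^-1%g k); rewrite ?inE permKV.
apply/idP/idP => [iL|].
  rewrite -[i.+1](@card_ord_lt n) ?ltn_ord //; apply/subset_leq_card/subsetP => k.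
  by rewrite !inE ltnS => /s_mono ki; exact: leq_ltn_trans ki iL.
apply: contraTT; rewrite -!leqNgt => iL; rewrite -(card_ord_lt (ltnW (ltn_ord i))).
apply/subset_leq_card/subsetP => k; rewrite !inE [(k < i)%N]ltnNge; apply: contraTN => /s_mono ik.
by rewrite -leqNgt (leq_trans iL).
Qed.

Lemma sorted_meanE h (s : 'S_n) :
  s \in rankings h -> \sum_(i < n) p i * (load h (s i))%:R = M h.
Proof.
move=> hs.
under eq_bigr => i _ do rewrite -(sumr_ltn_indicator R (load_le h (s i))) mulr_sumr.
rewrite exchange_big; apply: eq_bigr => L _ /=.
have bn := below_le h L.+1.
(* Layer [L] collects the ranks from [below h L.+1] upward, whose probabilities add up to
   [1 - P (below h L.+1)]. *)
rewrite -[X in X - _]cdfn -sum_rank_pr // (big_nat_widenl _ 0) // big_mkord [RHS]big_mkcond /=.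
apply: eq_bigr => i _; rewrite -mulrb -[RHS]mulr_natr; congr (_ * _%:R).
by rewrite ltnNge -ltnS (below_ranked _ _ hs) -leqNgt.
Qed.

(* The potential, with the square expanded; see [deviationE]. *)
Definition deviation h : R :=
  \sum_j (load h j)%:R ^+ 2 - 2 * (size h)%:R * M h + (size h)%:R ^+ 2 * Q.

Lemma deviationE h (s : 'S_n) : s \in rankings h ->
  \sum_(i < n) ((load h (s i))%:R - p i * (size h)%:R) ^+ 2 = deviation h.
Proof.
move=> hs; rewrite /deviation -(sorted_meanE hs) [X in X - _](reindex_inj (@perm_inj _ s)) /=.
rewrite /Q !mulr_sumr -sumrB -big_split /=; apply: eq_bigr => i _; ring.
Qed.

Lemma sum_sq_load_rcons h j :
  \sum_k (load (rcons h j) k)%:R ^+ 2 =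
  \sum_k (load h k)%:R ^+ 2 + 2 * (load h j)%:R + 1 :> R.
Proof.
rewrite (bigD1 j) //= [in RHS](bigD1 j) //= load_rcons eqxx addn1.
rewrite (eq_bigr (fun k => (load h k)%:R ^+ 2)) => [|k /negPf kj].
  by rewrite -natr1; ring.
by rewrite load_rcons eq_sym kj addn0.
Qed.

Lemma step_deviation_le h :
  \sum_j step_pr R d h j * deviation (rcons h j) <= deviation h + 1.
Proof.
pose t : R := (size h)%:R; pose V : R := \sum_k (load h k)%:R ^+ 2.
(* [c] gathers the terms of [deviation (rcons h j)] that do not depend on [j]. *)
pose c := V + 1 - 2 * (t + 1) * M h + (t + 1) ^+ 2 * Q.
have -> : \sum_j step_pr R d h j * deviation (rcons h j) =
    c * \sum_j step_pr R d h j + 2 * \sum_j step_pr R d h j * (load h j)%:R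
    - 2 * (t + 1) * \sum_j step_pr R d h j * p (below h (load h j).+1).-1.
  rewrite !mulr_sumr -big_split -sumrB /=; apply: eq_bigr => j _.
  rewrite /deviation size_rcons sum_sq_load_rcons sorted_mean_rcons -natr1 /c /V /t.
  ring.
rewrite step_pr_sum1 // step_mean_load.
have := step_sorted_mean_ge h.
have t_ge0 : 0 <= t by exact: ler0n.
have Q_ge0 : 0 <= Q by apply: sumr_ge0 => i _; exact: sqr_ge0.
(* With [S] the expected increase of [M], cancellation leaves [(2 * t + 1) * Q <= 2 * (t + 1) * S],
   which follows from [Q <= S] and [0 <= Q]. *)
rewrite -(ler_pM2l (_ : 0 < 2 * (t + 1))); last by lra.
rewrite /deviation -/t -/V /c; set S := \sum_j _ => H.
by lra.
Qed.

Lemma history_pr_rcons m (h : m.-tuple 'I_n) j :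
  history_pr R d [tuple of rcons h j] = history_pr R d h * step_pr R d h j.
Proof.
rewrite /history_pr big_ord_recr /=; congr (_ * _).
  apply: eq_bigr => t _; rewrite (tnth_nth j) /= (tnth_nth j) nth_rcons size_tuple.
  by rewrite ltn_ord -cats1 takel_cat // size_tuple ltnW.
rewrite (tnth_nth j) /= nth_rcons size_tuple ltnn eqxx -cats1 take_cat.
by rewrite size_tuple ltnn subnn take0 cats0.
Qed.

Lemma step_pr_ge0 h j : 0 <= step_pr R d h j.
Proof.
by apply: sumr_ge0 => o _; rewrite mulr_ge0 ?divr_ge0 ?invr_ge0 ?exprn_ge0 ?ler0n.
Qed.

Lemma history_pr_ge0 m (h : m.-tuple 'I_n) : 0 <= history_pr R d h.
Proof. by apply: prodr_ge0 => t _; exact: step_pr_ge0. Qed.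

Lemma expected_deviation_le m :
  \sum_(h : m.-tuple 'I_n) history_pr R d h * deviation h <= m%:R.
Proof.
elim: m => [|m IH].
  rewrite big1 // => h _; rewrite /deviation tuple0 /= mulr0 mul0r subr0 expr0n mul0r addr0.
  by rewrite big1 ?mulr0 // => j _; rewrite /load /= expr0n.
rewrite big_tuple_rcons -natr1; apply: le_trans (lerD IH (lexx 1)).
rewrite -[X in _ <= _ + X](history_pr_sum1 R m n_gt0 d_gt0) -big_split /=; apply: ler_sum => h _.
rewrite -[X in _ + X]mulr1 -mulrDr; under eq_bigr => j _ do rewrite history_pr_rcons -mulrA.
rewrite -mulr_sumr ler_wpM2l ?history_pr_ge0 ?step_deviation_le //.
Qed.

End OneStep.

(** * From the potential bound to means and tails *)

Section UnfairBounds.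
Variables (R : realType) (n d m : nat).
Hypotheses (n_gt0 : (0 < n)%N) (d_gt0 : (0 < d)%N).
Local Notation outcome := (outcome n m).
Local Notation p := (rank_pr R n d).
Local Notation E := (@unfair_E R n d m).

(** Jensen for the square: [(X w - a) ^+ 2] exceeds its tangent line at [E X] by [(X w - E X) ^+ 2],
    and the linear term has mean zero. *)
Lemma sqr_unfair_E_le (X : outcome -> R) a :
  (E X - a) ^+ 2 <= E (fun w => (X w - a) ^+ 2).
Proof.
have affine b c mu : E (fun w => b + c * (X w - mu)) = b + c * (E X - mu).
  rewrite -[b in RHS]mulr1 -(unfair_pr_sum1 R m n_gt0 d_gt0) mulrBr.
  rewrite -[c * mu]mulr1 -(unfair_pr_sum1 R m n_gt0 d_gt0) /unfair_E !mulr_sumr.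
  by rewrite -sumrB -big_split /=; apply: eq_bigr => w _; ring.
have -> : (E X - a) ^+ 2 =
    E (fun w => (E X - a) ^+ 2 + 2 * (E X - a) * (X w - E X)).
  by rewrite affine subrr mulr0 addr0.
apply: ler_sum => w _; rewrite ler_wpM2l ?unfair_pr_ge0 // -subr_ge0.
by rewrite [leRHS](_ : _ = (X w - E X) ^+ 2) ?sqr_ge0 //; ring.
Qed.

(** Given the history, the sum of squares is the same for every admissible ranking, so averaging
    over rankings leaves [deviation]. *)
Lemma sum_sq_deviation_le :
  \sum_(i < n) E (fun w => ((ranked_load i w)%:R - p i * m%:R) ^+ 2) <= m%:R.
Proof.
rewrite exchange_big /=; apply: le_trans (expected_deviation_le R n_gt0 d_gt0 m).
rewrite -(pair_bigA _ (fun h s => \sum_(i < n) unfair_pr R d (h, s) *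
  ((ranked_load i (h, s))%:R - p i * m%:R) ^+ 2)) /=.
rewrite le_eqVlt; apply/orP; left; apply/eqP; apply: eq_bigr => h _.
transitivity (\sum_s history_pr R d h *
    ((s \in rankings h)%:R / #|rankings h|%:R) * deviation R d h).
  apply: eq_bigr => s _; rewrite -mulr_sumr /unfair_pr /=.
  case: (boolP (s \in _)) => [hs|_]; last by rewrite !(mul0r, mulr0).
  by rewrite -(deviationE R d n_gt0 hs) size_tuple.
by rewrite -mulr_suml -mulr_sumr uniform_sum1 ?mulr1 // rankings_gt0.
Qed.

Lemma expected_load_deviation_le (i : 'I_n) :
  (expected_load R d m i - p i * m%:R) ^+ 2 <= m%:R.
Proof.
apply: le_trans sum_sq_deviation_le; apply: le_trans (sqr_unfair_E_le (fun w => (ranked_load i w)%:R) _) _.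
rewrite [leRHS](bigD1 i) //= lerDl; apply: sumr_ge0 => k _; apply: sumr_ge0 => w _.
by rewrite mulr_ge0 ?unfair_pr_ge0 ?sqr_ge0.
Qed.

(** Markov for the sum over all ranks at once: one rank off by more than [eps] already brings the
    sum to [eps ^+ 2], so no union bound is needed. *)
Lemma unfair_Pr_deviation_ge (eps : R) (A : {set outcome}) : 0 < eps ->
  (forall w, (forall i : 'I_n, `|(ranked_load i w)%:R - p i * m%:R| <= eps) -> w \in A) ->
  1 - m%:R / eps ^+ 2 <= unfair_Pr R d A.
Proof.
move=> eps_gt0 goodA; have eps2_gt0 : 0 < eps ^+ 2 by rewrite exprn_gt0.
rewrite lerBlDr -[leLHS](unfair_pr_sum1 R m n_gt0 d_gt0) (bigID (mem A)) /= lerD2l.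
rewrite ler_pdivlMr //; apply: le_trans sum_sq_deviation_le.
rewrite exchange_big /= mulr_suml big_mkcond; apply: ler_sum => w _ /=.
rewrite -mulr_sumr; case: ifPn => [wA|_]; last first.
  by rewrite mulr_ge0 ?unfair_pr_ge0 ?sumr_ge0 // => i _; exact: sqr_ge0.
rewrite ler_wpM2l ?unfair_pr_ge0 //.
have [i] : exists i : 'I_n, ~~ (`|(ranked_load i w)%:R - p i * m%:R| <= eps).
  by apply/existsP; rewrite -negb_forall; apply: contra wA => /forallP /goodA.
rewrite -ltNge => /ltW epsle; rewrite (bigD1 i) //= ler_wpDr //.
  by apply: sumr_ge0 => k _; exact: sqr_ge0.
by rewrite -[leRHS]real_normK ?num_real // lerXn2r ?nnegrE ?normr_ge0 ?(ltW eps_gt0).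
Qed.

End UnfairBounds.

Theorem theorem1 (R : realType) (d : nat) (d_gt0 : (0 < d)%N) :
  (exists2 C : R, 0 < C &
     forall n m : nat, (0 < n)%N -> (n ^ (4 * d + 13) < m)%N ->
     forall i : 'I_n,
       `| expected_load R d m i
          - ((i.+1%:R / n%:R) ^+ d - (i%:R / n%:R) ^+ d) * m%:R |
         <= C * (m%:R / n%:R ^+ d.+1))
  /\
  (exists2 C : R, 0 < C &
   exists2 K : R, 0 < K &
     forall n m : nat, (0 < n)%N -> (n ^ (4 * d + 13) < m)%N ->
       1 - K / n%:R ^+ d <=
       unfair_Pr R d [set w : outcome n m | [forall i : 'I_n,
         `| (ranked_load i w)%:R - expected_load R d m i |
           <= C * (m%:R / n%:R ^+ d.+1)]]).
Proof.
have big_m (n m e : nat) : (0 < n)%N -> (n ^ (4 * d + 13) < m)%N -> (e <= 4 * d + 13)%N ->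
    n%:R ^+ e <= m%:R :> R.
  move=> n_gt0 nm ed; rewrite -natrX ler_nat; apply: leq_trans (ltnW nm).
  by rewrite leq_pexp2l.
have mean_close n m : (0 < n)%N -> (n ^ (4 * d + 13) < m)%N -> forall i : 'I_n,
    `|expected_load R d m i - rank_pr R n d i * m%:R| <= m%:R / n%:R ^+ d.+1.
  move=> n_gt0 nm i; have n0 : 0 < n%:R :> R by rewrite ltr0n.
  rewrite -ler_sqr ?nnegrE ?divr_ge0 ?exprn_ge0 ?ler0n // real_normK ?num_real //.
  apply: le_trans (expected_load_deviation_le R m n_gt0 d_gt0 i) _.
  (* The bound [m <= (m / n ^+ d.+1) ^+ 2] amounts to [n ^+ (2 * d + 2) <= m]. *)
  rewrite expr_div_n -exprM ler_pdivlMr ?exprn_gt0 // [leRHS]expr2 ler_wpM2l ?ler0n //.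
  by apply: big_m => //; lia.
split; first by exists 1 => // n m n_gt0 nm i; rewrite mul1r; exact: mean_close.
(* The constant 2 comes from the triangle inequality through [p i * m]: one tolerance for the ranked
   load, one for its expectation. *)
exists 2 => //; exists 1 => // n m n_gt0 nm.
have n0 : 0 < n%:R :> R by rewrite ltr0n.
have m0 : 0 < m%:R :> R by rewrite ltr0n (leq_ltn_trans _ nm).
have eps_gt0 : 0 < m%:R / n%:R ^+ d.+1 :> R by rewrite divr_gt0 ?exprn_gt0.
apply: le_trans (unfair_Pr_deviation_ge n_gt0 d_gt0 eps_gt0 _) => [|w wi].
  (* With [eps = m / n ^+ d.+1], the bound [m / eps ^+ 2 <= 1 / n ^+ d] amounts to
     [n ^+ (3 * d + 2) <= m]. *)
  rewrite lerD2l lerN2 expr_div_n -exprM ler_pdivrMr ?divr_gt0 ?exprn_gt0 //.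
  rewrite mul1r mulrA ler_pdivlMr ?exprn_gt0 // ler_pdivlMl ?exprn_gt0 //.
  rewrite expr2 mulrCA ler_wpM2l ?ler0n // -exprD.
  by apply: big_m => //; lia.
rewrite inE; apply/forallP => i.
rewrite -(subrKA (rank_pr R n d i * m%:R)) mulr_natl mulr2n.
by apply: le_trans (ler_normD _ _) (lerD (wi i) _); rewrite distrC mean_close.
Qed.
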